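(* Let the dynamics satisfy $f_{S_k}(t,x,u)=f_k(t,x_{N_k},u_{M_k})$ for $k=1,\dots,K$ on the factor graph $\mathcal G=\{(S_k,N_k,M_k)\}_{k=1}^K$. Let $U=\sum_{k=1}^KU_k(t,x_{S_k})$ be a storage function with nonnegative $U_k\in C^1([t_0,T]\times X_{S_k})$, and let $w_k(t,x_{N_k},u_{M_k})$ be local supply rates satisfying $A_kU_k\le w_k$ for every $k$. Let the running cost be $\ell=\sum_k\ell_k(t,x_{N_k},u_{M_k})$ with $\sum_k(\ell_k-w_k)\ge0$ on $Z$. Suppose there exist $\phi_k\in C^1([t_0,T]\times X_{S_k})$ with $\phi_k\ge U_k$, $\phi_k$ vanishing wherever $U_k=0$, such that $$\sum_{k=1}^K\big(\ell_k+A_k\phi_k-w_k\big)\ge0\quad\text{on }Z.$$ Let the terminal cost be $g(x)=\sum_kg_k(x_{S_k})$ with $g_k\ge\phi_k(T,\cdot)-U_k(T,\cdot)$ pointwise on $X_{S_k}$. Then $v:=\sum_kv_k$ with $v_k:=\phi_k-U_k$ is a feasible OM-dual certificate, and there exist supply-rate budgets $\sigma_k(t,x_{N_k},u_{M_k})$ on the same factor graph $\mathcal G$ such that $s_k:=\ell_k+A_kv_k$ satisfies $s_k\ge\sigma_k$ for every $k$, $\sum_k\sigma_k\ge0$ on $Z$, and $v(T,\cdot)\le g$ on $X$.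
   Context: Setting. $t_0<T$, $X\subseteq\mathbb R^n$, control set $\mathcal U\subseteq\mathbb R^m$, $Z:=[t_0,T]\times X\times\mathcal U$, dynamics $f:Z\to\mathbb R^n$, running cost $\ell:Z\to\mathbb R$, terminal cost $g:X\to\mathbb R$. For $v\in C^1([t_0,T]\times X)$, $(L_fv)(t,x,u):=\partial_tv(t,x)+\nabla_xv(t,x)^\top f(t,x,u)$. $v$ is a feasible OM-dual certificate if $\ell+L_fv\ge0$ on $Z$ and $v(T,\cdot)\le g$ on $X$. Index sets: $S_k\subseteq\{1,\dots,n\}$, state neighborhoods $N_k\supseteq S_k$, $N_k\subseteq\{1,\dots,n\}$, and control index sets $M_k\subseteq\{1,\dots,m\}$, $k=1,\dots,K$; the collection $\mathcal G=\{(S_k,N_k,M_k)\}_{k=1}^K$ is called the factor graph. $x_S$ (resp. $u_M$, $f_S$) denotes the subvector of components indexed by $S$ (resp. $M$, $S$), and $X_S$ is the projection of $X$ onto the coordinates in $S$. The blockwise transport operator is $$(A_k\phi)(t,x_{N_k},u_{M_k}):=\partial_t\phi(t,x_{S_k})+\nabla_{x_{S_k}}\phi(t,x_{S_k})^\top f_k(t,x_{N_k},u_{M_k}),\qquad\phi\in C^1([t_0,T]\times X_{S_k}).$$ *)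

(* Defs.v *)
From HB Require Import structures.
From mathcomp Require Import all_boot all_order all_algebra.
From mathcomp Require Import all_classical all_reals all_analysis.
Set Implicit Arguments.
Unset Strict Implicit.
Unset Printing Implicit Defensive.
Import Order.TTheory GRing.Theory Num.Theory.
Import numFieldNormedType.Exports.
Local Open Scope classical_set_scope.
Local Open Scope ring_scope.

(* x_S: the subvector of x indexed by S, the indices in S being listed in the
   order of the enumeration of S. *)
Definition subvec (R : Type) (n : nat) (S : {set 'I_n}) (x : 'rV[R]_n) :
    'rV[R]_#|S| :=
  \row_(j < #|S|) x ord0 (enum_val j).

(* For S included in N, x_S as a function of x_N; see [subvec_subvec]. *)
Definition resubvec (R : Type) (n : nat) (S N : {set 'I_n}) (SN : S \subset N)
    (y : 'rV[R]_#|N|) : 'rV[R]_#|S| :=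
  \row_(j < #|S|)
    y ord0 (enum_rank_in (fintype.subsetP SN _ (enum_valP j)) (enum_val j)).

Lemma subvec_subvec (R : Type) (n : nat) (S N : {set 'I_n})
    (SN : S \subset N) (x : 'rV[R]_n) :
  resubvec SN (subvec N x) = subvec S x.
Proof.
apply/rowP => j; rewrite !mxE enum_rankK_in//.
exact: (fintype.subsetP SN _ (enum_valP j)).
Qed.

Definition dt (R : realType) (d : nat) (v : R -> 'rV[R]_d -> R)
    (t : R) (x : 'rV[R]_d) : R :=
  derive1 (v ^~ x) t.

Definition grad (R : realType) (d : nat) (v : R -> 'rV[R]_d -> R)
    (t : R) (x : 'rV[R]_d) : 'rV[R]_d :=
  \row_(j < d) 'D_(delta_mx ord0 j) (v t) x.

Definition dotr (R : realType) (d : nat) (a b : 'rV[R]_d) : R :=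
  \sum_(j < d) a ord0 j * b ord0 j.

(* C^1([t0, T] x Y) for an arbitrary subset Y of R^d, in the extension sense:
   the function is of class C^1 (differentiable, with continuous first partial
   derivatives) on an open neighbourhood of [t0, T] x Y.  Derivatives at points
   of [t0, T] x Y, including t = t0 and t = T, are those of this function. *)
Definition C1_on (R : realType) (d : nat) (t0 T : R) (Y : set 'rV[R]_d)
    (v : R -> 'rV[R]_d -> R) : Prop :=
  exists O : set (R * 'rV[R]_d),
    [/\ open O, `[t0, T] `*` Y `<=` O &
     forall p, O p ->
       [/\ differentiable (fun q : R * 'rV[R]_d => v q.1 q.2) p,
           {for p, continuous (fun q : R * 'rV[R]_d => dt v q.1 q.2)} &
           forall j : 'I_d, {for p, continuous
             (fun q : R * 'rV[R]_d => grad v q.1 q.2 ord0 j)}]].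

Section OMDual.
Context (R : realType) (n m : nat).

Definition Lie (f : R -> 'rV[R]_n -> 'rV[R]_m -> 'rV[R]_n)
    (v : R -> 'rV[R]_n -> R) (t : R) (x : 'rV[R]_n) (u : 'rV[R]_m) : R :=
  dt v t x + dotr (grad v t x) (f t x u).

Definition OM_dual_feasible (t0 T : R) (X : set 'rV[R]_n) (U : set 'rV[R]_m)
    (f : R -> 'rV[R]_n -> 'rV[R]_m -> 'rV[R]_n)
    (l : R -> 'rV[R]_n -> 'rV[R]_m -> R) (g : 'rV[R]_n -> R)
    (v : R -> 'rV[R]_n -> R) : Prop :=
  [/\ C1_on t0 T X v,
      forall t x u, t \in `[t0, T] -> X x -> U u ->
        0 <= l t x u + Lie f v t x u &
      forall x, X x -> v T x <= g x].

End OMDual.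

Record factor_graph (n m K : nat) := FactorGraph {
  blockS : 'I_K -> {set 'I_n};
  blockN : 'I_K -> {set 'I_n};
  blockM : 'I_K -> {set 'I_m};
  blockSN : forall k, blockS k \subset blockN k }.

Section Blocks.
Context (R : realType) (n m K : nat) (G : factor_graph n m K).

(* Functions of (t, x_{S_k}), of x_{S_k}, and of (t, x_{N_k}, u_{M_k}). *)
Definition block_fun (k : 'I_K) := R -> 'rV[R]_#|blockS G k| -> R.
Definition block_state_fun (k : 'I_K) := 'rV[R]_#|blockS G k| -> R.
Definition local_fun (k : 'I_K) :=
  R -> 'rV[R]_#|blockN G k| -> 'rV[R]_#|blockM G k| -> R.
Definition local_dynamics (k : 'I_K) :=
  R -> 'rV[R]_#|blockN G k| -> 'rV[R]_#|blockM G k| -> 'rV[R]_#|blockS G k|.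

Definition transport (k : 'I_K) (fk : local_dynamics k) (phi : block_fun k) :
    local_fun k :=
  fun t y z => let x := resubvec (blockSN G k) y in
    dt phi t x + dotr (grad phi t x) (fk t y z).

End Blocks.

(* Main.v *)
(* A_k is the derivative of (t, y) |-> phi(t, y) in the direction (1, f_k), so
   it is linear on C^1 functions, and by the chain rule through the linear maps
   (t, x) |-> (t, x_{S_k}) one gets L_f v = sum_k A_k v_k.  The budgets are
   sigma_k := l_k + A_k phi_k - w_k: their sum is nonnegative by hypothesis, and
   s_k - sigma_k = w_k - A_k U_k >= 0. *)
Require Import Defs.
From HB Require Import structures.
From mathcomp Require Import all_boot all_order all_algebra.
From mathcomp Require Import all_classical all_reals all_analysis.
Set Implicit Arguments.
Unset Strict Implicit.
Unset Printing Implicit Defensive.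
Import Order.TTheory GRing.Theory Num.Theory.
Import numFieldNormedType.Exports.
Local Open Scope classical_set_scope.
Local Open Scope ring_scope.

(** * Joint directional derivatives and the class C^1 *)

Definition uncurried (R : realType) (d : nat) (v : R -> 'rV[R]_d -> R)
    (q : R * 'rV[R]_d) : R := v q.1 q.2.

(** A directional derivative sees a function only along one line. This lets derivatives taken on
    different spaces be compared: partial against joint ones, and those before and after a linear
    projection. *)
Lemma eq_derive_line (R : numFieldType) (V V' W : normedModType R)
    (f : V -> W) (g : V' -> W) a a' v v' :
  (forall h : R, f (h *: v + a) = g (h *: v' + a')) -> 'D_v f a = 'D_v' g a'.
Proof.
move=> fg; have fga : f a = g a' by have := fg 0; rewrite !scale0r !add0r.
by rewrite /derive; under eq_fun do rewrite /= fg fga.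
Qed.

Section JointDerivative.
Context (R : realType) (d : nat).
Implicit Types (v : R -> 'rV[R]_d -> R) (q : R * 'rV[R]_d).

Lemma dt_derive v q : dt v q.1 q.2 = 'D_(1, 0) (uncurried v) q.
Proof.
rewrite /dt derive1E; apply: eq_derive_line => h.
by rewrite /uncurried/= scaler0 add0r.
Qed.

Lemma grad_derive v q (j : 'I_d) :
  grad v q.1 q.2 ord0 j = 'D_(0, delta_mx ord0 j) (uncurried v) q.
Proof.
rewrite /grad mxE; apply: eq_derive_line => h.
by rewrite /uncurried/= scaler0 add0r.
Qed.

(** Differentiability makes the derivative linear in its direction, so it suffices to expand
    [(c, a)] in the standard basis. With [c = 1] and [a] the velocity, the transport expression
    becomes a single directional derivative. *)
Lemma derive_dt_grad v q (c : R) (a : 'rV[R]_d) :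
  differentiable (uncurried v) q ->
  'D_(c, a) (uncurried v) q
    = c * dt v q.1 q.2 + dotr (grad v q.1 q.2) a.
Proof.
move=> dv; have -> : (c, a) = c *: (1, 0)
    + \sum_(j < d) a ord0 j *: (0, delta_mx ord0 j) :> R * 'rV[R]_d.
  have sumE (s : seq 'I_d) :
      \sum_(j <- s) a ord0 j *: ((0, delta_mx ord0 j) : R * 'rV[R]_d)
      = (0, \sum_(j <- s) a ord0 j *: delta_mx ord0 j).
    elim: s => [|i s ih]; first by rewrite !big_nil.
    by rewrite !big_cons ih; congr pair => /=; rewrite scaler0 addr0.
  rewrite sumE; congr pair => /=.
    by rewrite addr0 [LHS](esym (mulr1 c)).
  by rewrite scaler0 add0r -row_sum_delta.
rewrite deriveE// linearD linearZ linear_sum/= -deriveE// -dt_derive.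
congr (_ + _); apply: eq_bigr => j _.
by rewrite linearZ/= -deriveE// -grad_derive mulrC.
Qed.

(* Unlike the partial derivatives in C1_on, directional derivatives in all
   directions h are stable under composition with block_proj below. *)
Lemma C1_onP (t0 T : R) (Y : set 'rV[R]_d) v :
  C1_on t0 T Y v <-> exists W : set (R * 'rV[R]_d),
    [/\ open W, `[t0, T] `*` Y `<=` W &
     forall p, W p -> differentiable (uncurried v) p /\
       forall h, {for p, continuous (fun q => 'D_h (uncurried v) q)}].
Proof.
split; move=> [W [oW YW WP]]; exists W; (split; [exact: oW|exact: YW|]) => p Wp.
  have [dv ct cg] := WP p Wp; split; [exact: dv|case=> c a].
  (* The expansion into partials needs differentiability at [q], known only on [W]; since [W] is
     open, it holds near [p], which is enough to transfer continuity at [p]. *)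
  have E : \forall q \near p, c * dt v q.1 q.2
      + \sum_(j < d) grad v q.1 q.2 ord0 j * a ord0 j
      = 'D_(c, a) (uncurried v) q.
    near=> q; rewrite derive_dt_grad//.
    have /WP[] // : W q by near: q; exact: open_nbhs_nbhs.
  rewrite /prop_for /continuous_at -(nbhs_singleton E).
  apply: cvg_trans (near_eq_cvg E) _.
  apply: cvgD; first by apply: cvgM; [exact: cvg_cst|exact: ct].
  apply: (@cvg_big _ _ +%R) => [|j _].
    exact: add_continuous.
  by apply: cvgM; [exact: cg|exact: cvg_cst].
(* Conversely, the partials are the derivatives in the directions [(1, 0)] and
   [(0, delta_mx ord0 j)]. *)
have [dv cv] := WP p Wp; split=> // [|j].
- have -> : (fun q => dt v q.1 q.2) = 'D_(1, 0) (uncurried v).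
    by apply/funext => q; rewrite dt_derive.
  exact: cv.
- have -> : (fun q => grad v q.1 q.2 ord0 j)
      = 'D_(0, delta_mx ord0 j) (uncurried v).
    by apply/funext => q; rewrite grad_derive.
  exact: cv.
Unshelve. all: by end_near. Qed.

Lemma C1_on_differentiable (t0 T : R) (Y : set 'rV[R]_d) v t x :
  C1_on t0 T Y v -> t \in `[t0, T] -> Y x ->
  differentiable (uncurried v) (t, x).
Proof. by move=> [W [_ YW WP]] tT Yx; have [] // := WP (t, x) (YW _ _). Qed.

Lemma C1_on0 (t0 T : R) (Y : set 'rV[R]_d) : C1_on t0 T Y 0.
Proof.
apply/C1_onP; exists setT; split; [exact: openT|exact: subsetT|move=> p _].
split; first exact: differentiable_cst.
move=> h; have -> : 'D_h (uncurried (0 : R -> 'rV[R]_d -> R)) = cst 0.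
  by apply/funext => q; exact: derive_cst.
exact: cvg_cst.
Qed.

Lemma C1_onD (t0 T : R) (Y : set 'rV[R]_d) v1 v2 :
  C1_on t0 T Y v1 -> C1_on t0 T Y v2 -> C1_on t0 T Y (v1 + v2).
Proof.
move=> /C1_onP[W1 [oW1 YW1 P1]] /C1_onP[W2 [oW2 YW2 P2]]; apply/C1_onP.
exists (W1 `&` W2); split; first exact: openI.
  by move=> q Yq; split; [exact: YW1|exact: YW2].
move=> p [W1p W2p]; have [d1 c1] := P1 p W1p; have [d2 c2] := P2 p W2p.
split=> [|h]; first exact: (differentiableD d1 d2).
(* The derivative of the sum splits wherever both summands are differentiable, hence on the
   neighbourhood [W1]&[W2] of [p]. *)
have E : \forall q \near p, 'D_h (uncurried v1) q + 'D_h (uncurried v2) q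
    = 'D_h (uncurried (v1 + v2)) q.
  near=> q; have [q1 q2] : (W1 `&` W2) q.
    by near: q; apply: open_nbhs_nbhs; split=> //; exact: openI.
  by rewrite -deriveD//; apply: diff_derivable; [case: (P1 q)|case: (P2 q)].
rewrite /prop_for /continuous_at -(nbhs_singleton E).
apply: cvg_trans (near_eq_cvg E) _.
by apply: cvgD; [exact: c1|exact: c2].
Unshelve. all: by end_near. Qed.

Lemma C1_onN (t0 T : R) (Y : set 'rV[R]_d) v :
  C1_on t0 T Y v -> C1_on t0 T Y (- v).
Proof.
move=> /C1_onP[W [oW YW P]]; apply/C1_onP; exists W.
split; [exact: oW|exact: YW|move=> p Wp].
have [dv cv] := P p Wp; split=> [|h]; first exact: (differentiableN dv).
have E : \forall q \near p, - 'D_h (uncurried v) q = 'D_h (uncurried (- v)) q.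
  near=> q; have /P[dq _] : W q by near: q; exact: open_nbhs_nbhs.
  by rewrite -deriveN//; exact: diff_derivable.
rewrite /prop_for /continuous_at -(nbhs_singleton E).
apply: cvg_trans (near_eq_cvg E) _.
by apply: cvgN; exact: cv.
Unshelve. all: by end_near. Qed.

Lemma C1_on_sum (t0 T : R) (Y : set 'rV[R]_d) (I : finType)
    (v : I -> R -> 'rV[R]_d -> R) :
  (forall i, C1_on t0 T Y (v i)) ->
  C1_on t0 T Y (fun t x => \sum_i v i t x).
Proof.
move=> Cv; have -> : (fun t x => \sum_i v i t x) = \sum_i v i.
  by apply/funext => t; apply/funext => x; rewrite !fct_sumE.
apply: big_ind; [exact: C1_on0|exact: C1_onD|by move=> i _; exact: Cv].
Qed.

End JointDerivative.

(** * Composition with coordinate projections *)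

Section Subvec.
Context (R : realType) (n : nat) (S : {set 'I_n}).

Lemma subvec_is_linear : linear (@subvec R n S).
Proof. by move=> c x y; apply/rowP => j; rewrite !mxE. Qed.

HB.instance Definition _ :=
  GRing.isLinear.Build R 'rV[R]_n 'rV[R]_#|S| *:%R (@subvec R n S)
    subvec_is_linear.

Lemma subvec_continuous : continuous (@subvec R n S).
Proof.
(* Balls are taken entrywise and the entries of [subvec S x] are among those of [x], so the same
   radius works. *)
move=> x A /nbhs_ballP[e e0 eA]; apply/nbhs_ballP; exists e => // y [_ xy].
by apply: eA; split=> // i j; rewrite !mxE; exact: xy.
Qed.

Definition block_proj (q : R * 'rV[R]_n) : R * 'rV[R]_#|S| :=
  (q.1, subvec S q.2).

Lemma block_proj_differentiable q : differentiable block_proj q.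
Proof.
apply: differentiable_pair.
  by apply: linear_differentiable => ?; exact: cvg_fst.
apply: (@differentiable_comp _ _ _ _ snd).
  by apply: linear_differentiable => ?; exact: cvg_snd.
exact/linear_differentiable/subvec_continuous.
Qed.

Lemma block_proj_continuous : continuous block_proj.
Proof.
by move=> q; apply: differentiable_continuous; exact: block_proj_differentiable.
Qed.

(** A linear map sends the line through [q] along [h] to the line through its image along
    [block_proj h]. The chain rule thus holds for every [F], by comparing difference quotients. *)
Lemma derive_block_proj (F : R * 'rV[R]_#|S| -> R) q h :
  'D_h (F \o block_proj) q = 'D_(block_proj h) F (block_proj q).
Proof.
apply: eq_derive_line => c; congr F.
by rewrite /block_proj/= linearD linearZ.
Qed.

Lemma C1_on_subvec (t0 T : R) (X : set 'rV[R]_n) (v : R -> 'rV[R]_#|S| -> R) :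
  C1_on t0 T (subvec S @` X) v ->
  C1_on t0 T X (fun t x => v t (subvec S x)).
Proof.
move=> /C1_onP[W [oW YW P]]; apply/C1_onP; exists (block_proj @^-1` W); split.
- by apply: open_comp => // q _; exact: block_proj_continuous.
- move=> [t x] [/= tT Xx]; apply: YW; split=> //=.
  by exists x.
move=> p /P[dv cv]; split=> [|h].
  exact: (differentiable_comp (block_proj_differentiable p) dv).
have -> : 'D_h (uncurried (fun t x => v t (subvec S x)))
    = 'D_(block_proj h) (uncurried v) \o block_proj.
  by apply/funext => q; exact: derive_block_proj.
by apply: continuous_comp; [exact: block_proj_continuous|exact: cv].
Qed.

End Subvec.

(** * Block transport and the Lie derivative *)

Lemma transportB (R : realType) (n m K : nat) (G : factor_graph n m K) k
    (fk : local_dynamics R G k) (phi psi : block_fun R G k) t y z :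
  differentiable (uncurried phi) (t, resubvec (blockSN G k) y) ->
  differentiable (uncurried psi) (t, resubvec (blockSN G k) y) ->
  transport fk (fun t y => phi t y - psi t y) t y z
    = transport fk phi t y z - transport fk psi t y z.
Proof.
move=> dphi dpsi; set x := resubvec _ _ in dphi dpsi.
have dB := differentiableB dphi dpsi.
rewrite /transport/= -/x.
(* The direction [(1, fk t y z)] is the same for [phi], [psi] and their difference. *)
have E (v : block_fun R G k) : differentiable (uncurried v) (t, x) ->
    dt v t x + dotr (grad v t x) (fk t y z)
    = 'D_(1, fk t y z) (uncurried v) (t, x).
  by move=> /derive_dt_grad ->; rewrite mul1r.
by rewrite !E// -deriveB//; exact: diff_derivable.
Qed.

(** [block_proj] maps the direction [(1, f t x u)] to [(1, fk k ...)] because the dynamics are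
    local. Each summand is differentiated on its own, so overlapping blocks do no harm. *)
Lemma Lie_sum_transport (R : realType) (n m K : nat) (G : factor_graph n m K)
    (f : R -> 'rV[R]_n -> 'rV[R]_m -> 'rV[R]_n)
    (fk : forall k, local_dynamics R G k) (v : forall k, block_fun R G k)
    t x u :
  (forall k, differentiable (uncurried (v k)) (t, subvec (blockS G k) x)) ->
  (forall k, subvec (blockS G k) (f t x u)
    = fk k t (subvec (blockN G k) x) (subvec (blockM G k) u)) ->
  Lie f (fun t x => \sum_(k < K) v k t (subvec (blockS G k) x)) t x u
    = \sum_(k < K) transport (fk k) (v k) t
        (subvec (blockN G k) x) (subvec (blockM G k) u).
Proof.
move=> dv fE; set V := fun t x => _.
have VE : uncurried V
    = \sum_(k < K) (uncurried (v k) \o @block_proj R n (blockS G k)).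
  by apply/funext => q; rewrite fct_sumE.
have dvk (k : 'I_K) : differentiable
    (uncurried (v k) \o @block_proj R n (blockS G k)) (t, x).
  by apply: differentiable_comp; [exact: block_proj_differentiable|exact: dv].
have dV : differentiable (uncurried V) (t, x).
  by rewrite VE; exact: differentiable_sum.
transitivity ('D_(1, f t x u) (uncurried V) (t, x)).
  by rewrite derive_dt_grad// mul1r.
rewrite VE derive_sum; last by move=> k; exact: diff_derivable.
apply: eq_bigr => k _; rewrite derive_block_proj derive_dt_grad; last exact: dv.
by rewrite mul1r /transport/= subvec_subvec fE.
Qed.

(** * The certificate and its budgets *)

Theorem proposition4 (R : realType) (n m K : nat) (t0 T : R) (t0T : t0 < T)
    (X : set 'rV[R]_n) (Uc : set 'rV[R]_m)
    (f : R -> 'rV[R]_n -> 'rV[R]_m -> 'rV[R]_n)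
    (l : R -> 'rV[R]_n -> 'rV[R]_m -> R) (g : 'rV[R]_n -> R)
    (G : factor_graph n m K)
    (fk : forall k, local_dynamics R G k)
    (U phi : forall k, block_fun R G k)
    (w lk : forall k, local_fun R G k)
    (gk : forall k, block_state_fun R G k)
    (f_local : forall k t x u, t \in `[t0, T] -> X x -> Uc u ->
      subvec (blockS G k) (f t x u)
        = fk k t (subvec (blockN G k) x) (subvec (blockM G k) u))
    (U_C1 : forall k, C1_on t0 T (subvec (blockS G k) @` X) (U k))
    (U_ge0 : forall k t y, t \in `[t0, T] -> (subvec (blockS G k) @` X) y ->
      0 <= U k t y)
    (U_supply : forall k t y z, t \in `[t0, T] ->
      (subvec (blockN G k) @` X) y -> (subvec (blockM G k) @` Uc) z ->
      transport (fk k) (U k) t y z <= w k t y z)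
    (l_sum : forall t x u, t \in `[t0, T] -> X x -> Uc u ->
      l t x u
        = \sum_(k < K) lk k t (subvec (blockN G k) x) (subvec (blockM G k) u))
    (lw_ge0 : forall t x u, t \in `[t0, T] -> X x -> Uc u ->
      0 <= \sum_(k < K)
             (lk k t (subvec (blockN G k) x) (subvec (blockM G k) u)
              - w k t (subvec (blockN G k) x) (subvec (blockM G k) u)))
    (phi_C1 : forall k, C1_on t0 T (subvec (blockS G k) @` X) (phi k))
    (phi_geU : forall k t y, t \in `[t0, T] -> (subvec (blockS G k) @` X) y ->
      U k t y <= phi k t y)
    (phi_eq0 : forall k t y, t \in `[t0, T] -> (subvec (blockS G k) @` X) y ->
      U k t y = 0 -> phi k t y = 0)
    (phi_budget : forall t x u, t \in `[t0, T] -> X x -> Uc u ->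
      0 <= \sum_(k < K)
             (lk k t (subvec (blockN G k) x) (subvec (blockM G k) u)
              + transport (fk k) (phi k) t
                  (subvec (blockN G k) x) (subvec (blockM G k) u)
              - w k t (subvec (blockN G k) x) (subvec (blockM G k) u)))
    (g_sum : forall x, X x -> g x = \sum_(k < K) gk k (subvec (blockS G k) x))
    (gk_ge : forall k y, (subvec (blockS G k) @` X) y ->
      phi k T y - U k T y <= gk k y) :
  let vk : forall k, block_fun R G k := fun k t y => phi k t y - U k t y in
  let v : R -> 'rV[R]_n -> R :=
    fun t x => \sum_(k < K) vk k t (subvec (blockS G k) x) in
  let s : forall k, local_fun R G k :=
    fun k t y z => lk k t y z + transport (fk k) (vk k) t y z in
  OM_dual_feasible t0 T X Uc f l g v /\
  exists sigma : forall k, local_fun R G k,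
    [/\ forall k t y z, t \in `[t0, T] ->
          (subvec (blockN G k) @` X) y -> (subvec (blockM G k) @` Uc) z ->
          sigma k t y z <= s k t y z,
        forall t x u, t \in `[t0, T] -> X x -> Uc u ->
          0 <= \sum_(k < K)
                 sigma k t (subvec (blockN G k) x) (subvec (blockM G k) u) &
        forall x, X x -> v T x <= g x].
Proof.
move=> vk v s.
have vk_C1 k : C1_on t0 T (subvec (blockS G k) @` X) (vk k).
  exact: C1_onD (phi_C1 k) (C1_onN (U_C1 k)).
pose sigma k : local_fun R G k := fun t y z =>
  lk k t y z + transport (fk k) (phi k) t y z - w k t y z.
have sigma_le k t y z : t \in `[t0, T] ->
    (subvec (blockN G k) @` X) y -> (subvec (blockM G k) @` Uc) z ->
    sigma k t y z <= s k t y z.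
  move=> tT Xy Uz; rewrite /s /sigma.
  (* As [y] is the restriction of some state in [X], so is its own restriction to [blockS G k];
     there the C^1 hypotheses give differentiability. *)
  have Xr : (subvec (blockS G k) @` X) (resubvec (blockSN G k) y).
    by case: Xy => x Xx <-; exists x => //; rewrite subvec_subvec.
  (* The common part [lk + transport phi] cancels, leaving the supply inequality for [U k]. *)
  rewrite transportB ?addrA ?lerD2l ?lerN2; first exact: U_supply.
  - exact: C1_on_differentiable (phi_C1 k) tT Xr.
  - exact: C1_on_differentiable (U_C1 k) tT Xr.
have v_le_g x : X x -> v T x <= g x.
  by move=> Xx; rewrite g_sum//; apply: ler_sum => k _; apply: gk_ge; exists x.
split; last by exists sigma; split.
split=> // [|t x u tT Xx Uu].
  by apply: C1_on_sum => k; exact: C1_on_subvec.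
rewrite l_sum// (Lie_sum_transport (fk := fk)); last 2 first.
- move=> k; apply: C1_on_differentiable (vk_C1 k) tT _.
  by exists x.
- by move=> k; exact: f_local.
(* The left-hand side of [phi_budget] is the sum of the [sigma k], and the goal is now the sum of
   the [s k], so the blockwise bound [sigma_le] concludes. *)
rewrite -big_split/=; apply: le_trans (phi_budget t x u tT Xx Uu) _.
by apply: ler_sum => k _; apply: sigma_le => //.
Qed.
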